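(* Let $A,B\in\mathbb{R}^{N\times N}$ be symmetric and let $\omega>0$, $\Delta t>0$ with $\sin(\omega\Delta t)\neq 0$. Put $$\alpha=\frac{(\omega\Delta t)^2}{2-2\cos(\omega\Delta t)},\qquad \beta=\frac{\omega\Delta t}{\sin(\omega\Delta t)},\qquad K=\frac{\Delta t^2}{\alpha}A,\qquad L=\frac{\beta\,\Delta t}{\alpha}B .$$ Assume that $H=-\omega^2 I+i\omega B+A$ is non-singular, that $K$ and $L$ are positive semidefinite, and that $4I-K$ is positive definite. Let $\chi$ be a $C^\infty$ admissible window function and let $S_T^{\rm acd}$ be the associated time-domain approximate solution operator. Then $$\lim_{T\to\infty}S_T^{\rm acd}=H^{-1},$$ where $T$ runs through the positive reals for which $2\pi T/(\omega\Delta t)$ is an integer.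
   Context: Admissible window function: a function $\chi:\mathbb{R}\to\mathbb{R}$ is a $C^k$ admissible window function if it is even, is of class $C^k$, and satisfies $\chi(0)=1$, $\chi(x)=0$ for $x\ge 1$, and $\chi$ is non-increasing on $[0,1]$. Time-domain approximate solution operator: let $T>0$ be such that $n_{\rm steps}:=2\pi\omega^{-1}T/\Delta t$ is an integer. For $F\in\mathbb{C}^N$ set $f_n=\chi\bigl(1-\tfrac{n\Delta t}{2\pi\omega^{-1}T}\bigr)e^{i\omega n\Delta t}F$, and define $u_n\in\mathbb{C}^N$ by $u_{-1}=u_0=0$ and, for $n\ge0$, $$u_{n+1}=\bigl(I+\tfrac12L\bigr)^{-1}\Bigl((2I-K)u_n-(I-\tfrac12L)u_{n-1}+\tfrac{\Delta t^2}{\alpha}f_n\Bigr).$$ Then $S_T^{\rm acd}:\mathbb{C}^N\to\mathbb{C}^N$ is the linear map $S_T^{\rm acd}F=e^{-i2\pi T}u_{n_{\rm steps}}$. *)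

(* Defs.v *)
From HB Require Import structures.
From mathcomp Require Export all_boot all_order all_algebra.
From mathcomp Require Export all_classical all_reals all_analysis.
From mathcomp Require Export complex.

Set Implicit Arguments.
Unset Strict Implicit.
Unset Printing Implicit Defensive.

Export Order.TTheory GRing.Theory Num.Theory.
Export numFieldNormedType.Exports.

Local Open Scope classical_set_scope.
Local Open Scope ring_scope.

(* The standard topology of R[i], given by the modulus; on 'M[R[i]]_n the
   library then derives the usual (entrywise, equivalently normwise) one. *)
HB.instance Definition _ (R : rcfType) := NormedModule.copy R[i] R[i]^o.

Definition expi (R : realType) (x : R) : R[i] := (cos x +i* sin x)%C.

Definition cplx_mx (R : realType) m n (M : 'M[R]_(m, n)) : 'M[R[i]]_(m, n) :=
  map_mx (real_complex R) M.

Definition psdmx (R : realType) n (M : 'M[R]_n) : Prop :=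
  forall x : 'cV[R]_n, 0 <= (x^T *m M *m x) 0 0.

Definition pdmx (R : realType) n (M : 'M[R]_n) : Prop :=
  forall x : 'cV[R]_n, x != 0 -> 0 < (x^T *m M *m x) 0 0.

Definition class_C (R : realType) (k : nat) (f : R -> R) : Prop :=
  (forall j, (j < k)%N -> forall x, derivable (derive1n j f) x 1) /\
  (forall j, (j <= k)%N -> continuous (derive1n j f)).

Definition admissible_window (R : realType) (k : nat) (chi : R -> R) : Prop :=
  [/\ (forall x, chi (- x) = chi x),
      class_C k chi,
      chi 0 = 1,
      (forall x, 1 <= x -> chi x = 0) &
      {in `[0, 1] &, forall x y, x <= y -> chi y <= chi x}].

Section approximate_solution_operator.
Variables (R : realType) (N : nat) (A B : 'M[R]_N) (omega dt : R).

Definition acd_alpha : R := (omega * dt) ^+ 2 / (2 - 2 * cos (omega * dt)).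

Definition acd_beta : R := omega * dt / sin (omega * dt).

Definition acd_K : 'M[R]_N := (dt ^+ 2 / acd_alpha) *: A.

Definition acd_L : 'M[R]_N := (acd_beta * dt / acd_alpha) *: B.

Definition helmholtz : 'M[R[i]]_N :=
  (- (omega ^+ 2)%:C%C)%:M + ('i%C * omega%:C%C) *: cplx_mx B + cplx_mx A.

Definition acd_steps (T : R) : R := 2 * pi * omega^-1 * T / dt.

Definition acd_times : set R :=
  [set T | 0 < T /\ acd_steps T \is a Num.int].

Variable chi : R -> R.

Section fixed_data.
Variables (T : R) (F : 'cV[R[i]]_N).

Definition acd_force (n : nat) : 'cV[R[i]]_N :=
  ((chi (1 - n%:R * dt / (2 * pi * omega^-1 * T)))%:C%C
     * expi (omega * n%:R * dt)) *: F.

(* The next iterate u_(n+1), given v = u_(n-1) and u = u_n. *)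
Definition acd_next (n : nat) (v u : 'cV[R[i]]_N) : 'cV[R[i]]_N :=
  invmx (1%:M + 2^-1 *: cplx_mx acd_L) *m
    ((2%:M - cplx_mx acd_K) *m u - (1%:M - 2^-1 *: cplx_mx acd_L) *m v
     + (dt ^+ 2 / acd_alpha)%:C%C *: acd_force n).

(* The pair (u_(n-1), u_n). *)
Fixpoint acd_pair (n : nat) : 'cV[R[i]]_N * 'cV[R[i]]_N :=
  if n is m.+1 then
    let: (v, u) := acd_pair m in (u, acd_next m v u)
  else (0, 0).

Definition acd_iterate (n : nat) : 'cV[R[i]]_N := (acd_pair n).2.

(* Used only for T in acd_times, where truncation is exact. *)
Definition acd_op : 'cV[R[i]]_N :=
  expi (- (2 * pi * T)) *: acd_iterate (Num.truncn (acd_steps T)).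

End fixed_data.

Definition acd_mx (T : R) : 'M[R[i]]_N :=
  \matrix_(i, j) acd_op T (delta_mx j 0) i 0.

Lemma acd_pair_linear T a F G n :
  acd_pair T (a *: F + G) n =
  (a *: (acd_pair T F n).1 + (acd_pair T G n).1,
   a *: (acd_pair T F n).2 + (acd_pair T G n).2).
Proof.
elim: n => [|n IHn] /=; first by rewrite !scaler0 !addr0.
rewrite IHn; case: (acd_pair T F n) => v u; case: (acd_pair T G n) => v' u' /=.
congr pair; rewrite /acd_next scalemxAr -mulmxDr; congr (_ *m _).
rewrite /acd_force !scalerDr !mulmxDr -!scalemxAr scalerN !scalerA opprD.
by rewrite (mulrC a) [RHS]addrACA; congr (_ + _); rewrite addrACA.
Qed.

Fact acd_op_linear T : linear (acd_op T).
Proof.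
move=> a F G.
by rewrite /acd_op /acd_iterate acd_pair_linear /= scalerDr !scalerA mulrC.
Qed.

HB.instance Definition _ T :=
  GRing.isLinear.Build R[i] 'cV[R[i]]_N 'cV[R[i]]_N _ (acd_op T)
    (acd_op_linear T).

Lemma acd_mxE T (F : 'cV[R[i]]_N) : acd_mx T *m F = acd_op T F.
Proof.
have {2}-> : F = \sum_j F j 0 *: delta_mx j 0.
  by rewrite {1}(matrix_sum_delta F); apply: eq_bigr => i _; rewrite big_ord1.
rewrite linear_sum; apply/matrixP => i j; rewrite (ord1 j) mxE summxE.
by apply: eq_bigr => k _; rewrite linearZ !mxE mulrC.
Qed.

End approximate_solution_operator.

(* Main.v *)
Require Import Defs.
From mathcomp Require Import ring lra.

(** The pair y_n = (u_(n-1), u_n) obeys y_(n+1) = G y_n + g_n z^n c with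
    z = e^(i omega dt), M the number of steps, g_n = chi(1 - n/M) and G a
    companion matrix; moreover c = (z - G) Y for the time-harmonic state
    Y = (z^-1 U, U), U = H^-1 F.  Hence, with W = z^-1 G,
      z^-M y_M = \sum_(m < M) chi((m+1)/M) W^m (1 - W) Y.
    Positivity of K, L and 4I - K puts the eigenvalues of G in the closed unit
    disc, so W^m grows at most polynomially, say like m^p; and z is not an
    eigenvalue of G because H is non-singular, so 1 - W is invertible.  Each
    summation by parts replaces the samples of chi by their differences, at the
    cost of a factor (1 - W)^-1.  The first one produces chi(1/M) Y, which tends
    to Y; after p + 2 of them the summand is O(M^-(p+2)) O(M^p) and the sum is
    O(1/M).  Smoothness of chi thus beats the growth of W^m, which does occur:
    z = 1 can be a defective eigenvalue of G when K is singular. *)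

Set Implicit Arguments.
Unset Strict Implicit.
Unset Printing Implicit Defensive.

Local Open Scope classical_set_scope.
Local Open Scope ring_scope.

(** * Polynomial growth of the powers of a matrix with eigenvalues in the closed unit disc *)

(** With base [n.+1] the inequality at [n = 0] reads [|a 0| <= c], which forces [c] to be
    nonnegative, hence real. *)
Definition polybounded (C : numDomainType) (p : nat) (a : nat -> C) : Prop :=
  exists c, forall n, `|a n| <= c * n.+1%:R ^+ p.

Lemma polyboundedD (C : numDomainType) (p : nat) (a b : nat -> C) :
  polybounded p a -> polybounded p b -> polybounded p (fun n => a n + b n).
Proof.
move=> [c ha] [d hb]; exists (c + d) => n; rewrite mulrDl.
by apply: le_trans (ler_normD _ _) _; apply: lerD.
Qed.

Lemma polyboundedZ (C : numDomainType) (p : nat) (x : C) (a : nat -> C) :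
  polybounded p a -> polybounded p (fun n => x * a n).
Proof.
by move=> [c ha]; exists (`|x| * c) => n; rewrite normrM -mulrA ler_wpM2l.
Qed.

Lemma polybounded_sum (C : numDomainType) (p : nat) (I : finType)
    (a : I -> nat -> C) :
  (forall i, polybounded p (a i)) -> polybounded p (fun n => \sum_i a i n).
Proof.
move=> ha; elim: (index_enum I) => [|i s IHs].
  by exists 0 => n; rewrite big_nil normr0 mul0r.
by under eq_fun do rewrite big_cons; apply: polyboundedD.
Qed.

(** As [|z| <= 1], each step adds at most the size of the increment; summing n increments of order
    n^p costs one degree. *)
Lemma polybounded_recurrence (C : numDomainType) (p : nat) (z : C)
    (a : nat -> C) :
  `|z| <= 1 -> polybounded p (fun n => a n.+1 - z * a n) ->
  polybounded p.+1 a.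
Proof.
move=> z1 [c hd]; exists (`|a 0%N| + c) => n.
have c0 : 0 <= c by have := hd 0%N; rewrite expr1n mulr1; apply: le_trans.
elim: n => [|n IHn]; first by rewrite expr1n mulr1 lerDl.
rewrite -[a n.+1](subrK (z * a n)).
apply: le_trans (ler_normD _ _) _; rewrite normrM.
have le1 : n.+1%:R <= n.+2%:R :> C by rewrite ler_nat.
(* (n+2)^(p+1) is split as (n+2)^p + (n+1)(n+2)^p: the first part absorbs the increment, the second
   the induction hypothesis. *)
apply: (@le_trans _ _ ((`|a 0%N| + c) * n.+2%:R ^+ p
                       + (`|a 0%N| + c) * (n.+1%:R * n.+2%:R ^+ p))).
  apply: lerD.
    apply: le_trans (hd n) _; apply: ler_pM => //; last first.
      by rewrite lerXn2r ?nnegrE.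
    by rewrite lerDr.
  apply: (@le_trans _ _ `|a n|); first by rewrite ler_piMl.
  apply: le_trans IHn _; rewrite exprS !ler_wpM2l ?addr_ge0 //.
  by rewrite lerXn2r ?nnegrE.
by rewrite -mulrDr exprS -[n.+2]add1n natrD (mulrDl 1) mul1r.
Qed.

(** This replaces the Jordan form: a factor [G - z%:M] turns [G ^+ n * Q] into its own defect in the
    recurrence with multiplier [z], so each factor removed costs one degree. [Q] stays general to
    collect the factors. *)
Lemma polybounded_mxexp_roots (C : numDomainType) d (G Q : 'M[C]_d.+1)
    (p : nat) (s : seq C) (i j : 'I_d.+1) :
  {in s, forall z, `|z| <= 1} ->
  polybounded p (fun n => (G ^+ n * \prod_(z <- s) (G - z%:M) * Q) i j) ->
  polybounded (size s + p) (fun n => (G ^+ n * Q) i j).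
Proof.
elim: s Q => [|z s IHs] Q hs; first by under eq_fun do rewrite big_nil mulr1.
move=> h; apply: (@polybounded_recurrence _ _ z); first by rewrite hs ?mem_head.
have e n : (G ^+ n.+1 * Q) i j - z * (G ^+ n * Q) i j
   = (G ^+ n * ((G - z%:M) * Q)) i j.
  have -> : G ^+ n * ((G - z%:M) * Q) = G ^+ n.+1 * Q - z *: (G ^+ n * Q).
    rewrite mulrBl mulrBr !mulrA -exprSr -scalemx1 -scalerAr -!scalerAl.
    by rewrite mulr1.
  by rewrite [RHS]mxE [X in _ = _ + X]mxE [X in _ = _ - X]mxE.
under eq_fun do rewrite e.
apply: IHs => [y ys|]; first by rewrite hs // in_cons ys orbT.
have cm : \prod_(y <- s) (G - y%:M) * (G - z%:M)
          = (G - z%:M) * \prod_(y <- s) (G - y%:M).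
  apply: commr_sym; apply: commr_prod => y _.
  have cz A x : GRing.comm A (x%:M : 'M[C]_d.+1) by exact: comm_mx_scalar.
  by apply: commrB => //; apply: commr_sym; apply: commrB.
under eq_fun do rewrite -mulrA.
by move: h; under eq_fun do rewrite big_cons -cm -!mulrA.
Qed.

(** By Cayley-Hamilton the product over all roots of [char_poly G] vanishes, so the removal of
    factors starts from the zero sequence. *)
Lemma polybounded_mxexp (C : numClosedFieldType) d (G : 'M[C]_d.+1) :
  (forall z, eigenvalue G z -> `|z| <= 1) ->
  exists p, forall i j, polybounded p (fun n => (G ^+ n) i j).
Proof.
move=> hG; have [s hs] := closed_field_poly_normal (char_poly G).
move: hs; rewrite (monicP (char_poly_monic G)) scale1r => hs.
have es : {in s, forall z, `|z| <= 1}.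
  by move=> z zs; apply: hG; rewrite eigenvalue_root_char hs root_prod_XsubC.
exists (size s + 0)%N => i j.
suff: polybounded (size s + 0) (fun n => (G ^+ n * 1) i j).
  by under eq_fun do rewrite mulr1.
apply: (polybounded_mxexp_roots es).
have -> : \prod_(z <- s) (G - z%:M) = 0.
  have := Cayley_Hamilton G; rewrite hs rmorph_prod /= => <-.
  by apply: eq_bigr => z _; rewrite rmorphB /= horner_mx_X horner_mx_C.
by exists 0 => n; rewrite mulr0 mul0r mxE normr0 mul0r.
Qed.

Lemma polybounded_mulmx (C : numDomainType) d (p : nat) (W : 'M[C]_d) :
  (forall i j, polybounded p (fun n => (W ^+ n) i j)) ->
  forall (v : 'cV_d) i, polybounded p (fun n => (W ^+ n *m v) i 0).
Proof.
move=> hW v i; under eq_fun do rewrite mxE.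
apply: polybounded_sum => j; under eq_fun do rewrite mulrC.
exact: polyboundedZ.
Qed.

(** * Finite differences of the window function *)

Definition fdiff (V W : zmodType) (h : V) (f : V -> W) (x : V) : W :=
  f (x + h) - f x.

(** Each difference is one use of the mean value theorem. The derivatives form a family [g] so that
    the induction can pass to the family [fdiff h (g j)], on an interval shortened by [h] and with
    bound [c * h]. *)
Lemma iter_fdiff_bound (R : realType) (k : nat) (g : nat -> R -> R)
    (h b c : R) :
  0 < h ->
  (forall j, (j < k)%N -> forall x : R, is_derive x 1 (g j) (g j.+1 x)) ->
  (forall x, 0 <= x <= b -> `|g k x| <= c) ->
  forall x, 0 <= x -> x + k%:R * h <= b ->
  `|iter k (fdiff h) (g 0%N) x| <= c * h ^+ k.
Proof.
move=> h0; elim: k g b c => [|k IHk] g b c dg gc x x0 xb.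
  by rewrite mulr1 gc // x0 /=; move: xb; rewrite mul0r addr0.
rewrite iterSr exprS mulrA.
apply: (IHk (fun j => fdiff h (g j)) (b - h)) => //; last first.
- by move: xb; rewrite -natr1; lra.
- move=> y /andP[y0 yb]; rewrite /fdiff.
  have [|t _||t] := @MVT_segment _ (g k) (g k.+1) y (y + h); first lra.
  + exact: dg.
  + apply: derivable_within_continuous => t _.
    by have [] := dg k (ltnSn k) t.
  + rewrite in_itv /= => /andP[yt tyh] ->; rewrite addrAC subrr add0r normrM.
    by rewrite (gtr0_norm h0) ler_wpM2r ?(ltW h0) // gc //; lra.
- move=> j jk y; rewrite /fdiff.
  have d1 := dg j (ltnW jk) y; have d2 := dg j (ltnW jk) (y + h).
  apply: is_deriveB.
  rewrite -[g j.+1 (y + h)]mulr1.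
  have := @is_derive1_comp _ (g j) (shift h) y _ 1 d2.
  by apply; exact: is_derive_shift.
Qed.

Lemma derive1n_bounded (R : realType) (k : nat) (f : R -> R) (b : R) :
  0 <= b -> continuous (derive1n k f) ->
  exists2 c, 0 <= c & forall x, 0 <= x <= b -> `|derive1n k f x| <= c.
Proof.
move=> b0 cf.
have [|t _ ht] := @EVT_max _ (fun x => `|derive1n k f x|) 0 b b0.
  apply: continuous_subspaceT => x; apply: (cvg_norm (cf x)).
exists `|derive1n k f t| => // x xb; apply: ht; by rewrite in_itv.
Qed.

Lemma iter_fdiff_window_bound (R : realType) (chi : R -> R) (k : nat) :
  class_C k chi ->
  exists2 c, 0 <= c & forall h x, 0 < h <= 1 -> 0 <= x <= 1 ->
    `|iter k (fdiff h) chi x| <= c * h ^+ k.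
Proof.
move=> [dchi cchi].
(* For x and h at most 1 the points x, x + h, ..., x + k h stay in [0, 1 + k], so one bound on the
   derivative serves every h. *)
have [|c c0 hc] := derive1n_bounded (b := 1 + k%:R) _ (cchi k (leqnn k)).
  by rewrite addr_ge0.
exists c => // h x /andP[h0 h1] /andP[x0 x1].
apply: (@iter_fdiff_bound _ k (fun j => derive1n j chi) h (1 + k%:R)) => //.
  move=> j jk y; rewrite [derive1n j.+1 chi]/= derive1E.
  by apply: derivableP; apply: dchi.
by rewrite lerD // ler_piMr.
Qed.

Lemma iter_fdiff_eq0 (R : numDomainType) (f : R -> R) (k : nat) (a h : R) :
  0 <= h -> (forall x, a <= x -> f x = 0) ->
  forall x, a <= x -> iter k (fdiff h) f x = 0.
Proof.
move=> h0 f0; elim: k => [|k IHk] x ax; first exact: f0.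
by rewrite /= /fdiff !IHk ?subrr // ler_wpDr.
Qed.

(** * Limits in [R[i]] *)

Lemma cvg_real_complex (R : realType) (T : Type) (F : set_system T)
    (FF : Filter F) (f : T -> R) (a : R) :
  f x @[x --> F] --> a -> ((f x)%:C%C : R[i]) @[x --> F] --> (a%:C%C : R[i]).
Proof.
move=> fa; apply/cvgrPdist_lt => e e0.
(* The tolerance lives in [R[i]]; being positive there, it has zero imaginary part. *)
have ee : e = (complex.Re e)%:C%C.
  by rewrite RRe_real // realE (ltW e0).
have re0 : 0 < complex.Re e by rewrite -ltcR -ee.
move/cvgrPdist_lt: fa => /(_ _ re0); apply: filterS => x hx.
rewrite -raddfB /= ee normc_def /= expr0n /= addr0 sqrtr_sqr.
by rewrite ltcR.
Qed.

Lemma squeeze_complex (R : realType) (T : Type) (F : set_system T)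
    (FF : Filter F) (f : T -> R[i]) (g : T -> R) :
  (\forall x \near F, `|f x| <= (g x)%:C%C) ->
  g x @[x --> F] --> 0 -> f x @[x --> F] --> (0 : R[i]).
Proof.
move=> fg g0; apply/cvgr0Pnorm_lt => e e0.
have /cvgr0Pnorm_lt/(_ e e0) := cvg_real_complex FF g0.
apply: filterS2 fg => x fx; apply: le_lt_trans.
by apply: le_trans fx _; rewrite real_ler_norm // complex_real.
Qed.

(** * Summation by parts for windowed sums of matrix powers *)

Lemma sum_by_parts (C : comPzRingType) (b t : nat -> C) (M : nat) :
  \sum_(m < M) b m * (t m - t m.+1) =
  b 0%N * t 0%N - b M * t M + \sum_(m < M) (b m.+1 - b m) * t m.+1.
Proof.
elim: M => [|M IHM]; first by rewrite !big_ord0 subrr addr0.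
by rewrite !big_ord_recr /= IHM; ring.
Qed.

(** Samples start at 1/M instead of 0: the force at step n = M - 1 - m has weight chi(1 - n/M) =
    chi((m+1)/M). *)
Definition window_sample (R : realType) (chi : R -> R) (k M m : nat) : R :=
  iter k (fdiff M%:R^-1) chi (m.+1%:R / M%:R).

(** Order [k = 0] is the sum produced by the time stepping; higher orders arise by summation by
    parts. *)
Definition window_sum (R : realType) (chi : R -> R) d (W : 'M[R[i]]_d)
    (k : nat) (v : 'cV[R[i]]_d) (i : 'I_d) (M : nat) : R[i] :=
  \sum_(m < M) (window_sample chi k M m)%:C%C * (W ^+ m *m v) i 0.

Lemma window_sampleS (R : realType) (chi : R -> R) (k M m : nat) :
  window_sample chi k.+1 M m =
  window_sample chi k M m.+1 - window_sample chi k M m.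
Proof.
by rewrite /window_sample iterS {1}/fdiff -[m.+2%:R]natr1 mulrDl mul1r.
Qed.

(** The factor 1 - W makes the powers of W telescope, and Abel summation moves the difference onto
    the window. *)
Lemma window_sum_parts (R : realType) (chi : R -> R) d (W : 'M[R[i]]_d)
    (k : nat) (v : 'cV[R[i]]_d) (i : 'I_d) (M : nat) :
  (forall x, 1 <= x -> chi x = 0) ->
  window_sum chi W k ((1%:M - W) *m v) i M.+1 =
  (window_sample chi k M.+1 0)%:C%C * v i 0
  + window_sum chi W k.+1 (W *m v) i M.+1.
Proof.
move=> chi0; rewrite /window_sum.
transitivity (\sum_(m < M.+1) (window_sample chi k M.+1 m)%:C%C
    * ((W ^+ m *m v) i 0 - (W ^+ m.+1 *m v) i 0)).
  apply: eq_bigr => m _; congr (_ * _).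
  have -> : W ^+ m *m ((1%:M - W) *m v) = W ^+ m *m v - W ^+ m.+1 *m v.
    by rewrite exprSr -mulmxE -mulmxA mulmxBl mul1mx mulmxBr.
  by rewrite mxE [X in _ + X]mxE.
rewrite (sum_by_parts (fun m => (window_sample chi k M.+1 m)%:C%C)
   (fun m => (W ^+ m *m v) i 0)) /=.
(* The upper boundary sample involves only points from (M+2)/(M+1) onwards, where [chi] vanishes. *)
have -> : window_sample chi k M.+1 M.+1 = 0.
  apply: (@iter_fdiff_eq0 _ _ _ 1) => //.
  by rewrite ler_pdivlMr ?ltr0n // mul1r ler_nat.
rewrite mul0r subr0 expr0 mul1mx; congr (_ + _); apply: eq_bigr => m _.
by rewrite window_sampleS rmorphB /= exprSr -mulmxE mulmxA.
Qed.

Lemma window_sample_bound (R : realType) (chi : R -> R) (k : nat) :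
  class_C k chi ->
  exists2 c, 0 <= c & forall M m, (m < M)%N ->
    `|window_sample chi k M m| <= c / M%:R ^+ k.
Proof.
move=> /iter_fdiff_window_bound[c c0 hc]; exists c => // M m mM.
have M0 : 0 < M%:R :> R by rewrite ltr0n (leq_ltn_trans _ mM).
rewrite -exprVn; apply: hc.
  rewrite invr_gt0 M0 invf_le1 // ler1n; exact: leq_ltn_trans mM.
by rewrite divr_ge0 //= ler_pdivrMr // mul1r ler_nat.
Qed.

(** Differences of order p + 2 are O(M^-(p+2)) and the powers O(M^p), so the M terms add up to
    O(1/M). *)
Lemma window_sum_cvg0_large (R : realType) (chi : R -> R) d (W : 'M[R[i]]_d)
    (p : nat) (v : 'cV[R[i]]_d) (i : 'I_d) :
  class_C p.+2 chi -> polybounded p (fun n => (W ^+ n *m v) i 0) ->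
  window_sum chi W p.+2 v i M @[M --> \oo] --> (0 : R[i]).
Proof.
move=> /window_sample_bound[c c0 hc] [b hb].
have b0 : 0 <= b by have := hb 0%N; rewrite expr1n mulr1; apply: le_trans.
have eb : b = (complex.Re b)%:C%C by rewrite RRe_real // realE b0.
apply: (@squeeze_complex _ _ _ _ _
    (fun M => c * complex.Re b * M%:R^-1)); last first.
  rewrite -(mulr0 (c * complex.Re b)); apply: cvgMr.
  by rewrite -cvg_shiftS; exact: cvg_harmonic.
near=> M.
have M0 : (0 < M)%N by near: M; exact: nbhs_infty_gt.
have M0R : M%:R != 0 :> R[i] by rewrite pnatr_eq0 -lt0n.
apply: le_trans (ler_norm_sum _ _ _) _.
apply: (@le_trans _ _ (\sum_(m < M) (c%:C%C / M%:R ^+ p.+2)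
                         * (b * M%:R ^+ p))).
  apply: ler_sum => m _; rewrite normrM; apply: ler_pM => //.
    have := hc M m (ltn_ord m).
    rewrite -lecR rmorphM /= fmorphV rmorphXn /= rmorph_nat.
    by rewrite normc_def /= expr0n /= addr0 sqrtr_sqr.
  apply: le_trans (hb m) _; rewrite ler_wpM2l // lerXn2r ?nnegrE //.
  by rewrite ler_nat.
rewrite sumr_const card_ord -mulr_natr {1}eb !rmorphM /= fmorphV rmorph_nat.
rewrite le_eqVlt; apply/orP; left; apply/eqP; rewrite !exprS; field.
by rewrite mul1r M0R expf_neq0.
Unshelve. all: by end_near.
Qed.

Lemma window_sample0_cvg0 (R : realType) (chi : R -> R) (k : nat) :
  class_C k.+1 chi -> window_sample chi k.+1 M 0 @[M --> \oo] --> (0 : R).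
Proof.
move=> /window_sample_bound[c c0 hc].
apply/norm_cvg0P.
apply: (@squeeze_cvgr _ _ _ _ (fun=> 0) (fun M => c * M%:R^-1)).
- near=> M; rewrite normr_ge0 /=.
  have M0 : (0 < M)%N by near: M; exact: nbhs_infty_gt.
  apply: le_trans (hc M 0%N M0) _; rewrite ler_wpM2l //.
  rewrite lef_pV2 ?posrE ?exprn_gt0 ?ltr0n // ler_eXnr // ?ler1n //.
- exact: cvg_cst.
- rewrite -(mulr0 c); apply: cvgMr.
  by rewrite -cvg_shiftS; exact: cvg_harmonic.
Unshelve. all: by end_near.
Qed.

(** Limit form of the summation by parts, applied with [a] equal to 1 at order 0 and to 0 at higher
    orders. *)
Lemma window_sum_cvg_parts (R : realType) (chi : R -> R) d (W : 'M[R[i]]_d)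
    (k : nat) (a : R) (v : 'cV[R[i]]_d) (i : 'I_d) :
  (forall x, 1 <= x -> chi x = 0) ->
  window_sample chi k M 0 @[M --> \oo] --> a ->
  window_sum chi W k.+1 (W *m v) i M @[M --> \oo] --> (0 : R[i]) ->
  window_sum chi W k ((1%:M - W) *m v) i M @[M --> \oo] --> a%:C%C * v i 0.
Proof.
move=> chi0 sa s0; rewrite -cvg_shiftS.
under eq_fun do rewrite window_sum_parts //.
rewrite -(addr0 (a%:C%C * v i 0)); apply: cvgD; last by rewrite cvg_shiftS.
apply: cvgMl; rewrite (cvg_shiftS (fun M => (window_sample chi k M 0)%:C%C)).
exact: cvg_real_complex.
Qed.

Lemma window_sum_cvg0 (R : realType) (chi : R -> R) d (W : 'M[R[i]]_d)
    (p : nat) :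
  (forall k, class_C k chi) -> (forall x, 1 <= x -> chi x = 0) ->
  (forall i j, polybounded p (fun n => (W ^+ n) i j)) ->
  1%:M - W \in unitmx ->
  forall v i, window_sum chi W 1 v i M @[M --> \oo] --> (0 : R[i]).
Proof.
move=> Cchi chi0 hW uW.
(* Here [n] counts the summations by parts still to be made; at [n = 0] the order is p + 2 and the
   crude bound suffices. *)
suff: forall n k, (k + n = p.+1)%N -> forall v i,
    window_sum chi W k.+1 v i M @[M --> \oo] --> (0 : R[i]).
  by move=> /(_ p.+1 0%N erefl).
elim=> [|n IHn] k kn v i.
  move: kn; rewrite addn0 => ->; apply: window_sum_cvg0_large => //.
  exact: polybounded_mulmx.
rewrite -[v](mulKVmx uW) -(mul0r ((invmx (1%:M - W) *m v) i 0)).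
apply: window_sum_cvg_parts => //; first exact: window_sample0_cvg0.
by apply: IHn; rewrite addSnnS.
Qed.

Lemma window_sum_cvg (R : realType) (chi : R -> R) d (W : 'M[R[i]]_d)
    (p : nat) :
  (forall k, class_C k chi) -> chi 0 = 1 -> (forall x, 1 <= x -> chi x = 0) ->
  (forall i j, polybounded p (fun n => (W ^+ n) i j)) ->
  1%:M - W \in unitmx ->
  forall v i,
    window_sum chi W 0 ((1%:M - W) *m v) i M @[M --> \oo] --> v i 0.
Proof.
move=> Cchi chi1 chi0 hW uW v i.
(* The boundary sample is chi(1/M), which tends to chi(0) = 1 by continuity. *)
rewrite -[v i 0]mul1r; apply: (@window_sum_cvg_parts _ _ _ _ _ 1) => //.
  rewrite /window_sample /=; under eq_fun do rewrite div1r.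
  have : chi M%:R^-1 @[M --> \oo] --> chi 0.
    apply: (@cvg_comp _ _ _ (fun M => M%:R^-1 : R) chi _ (nbhs (0 : R))).
      by rewrite -cvg_shiftS; exact: cvg_harmonic.
    by have [_ /(_ 0%N isT) c] := Cchi 0%N; exact: c.
  by rewrite chi1.
exact: window_sum_cvg0 hW uW _ _.
Qed.

(** * Eigenvalues of the companion matrix through a quadratic pencil *)

(* Jury's criterion. *)
Lemma quadratic_root_norm_le1 (R : rcfType) (a b c : R) (z : R[i]) :
  0 < a -> c <= a -> `|b| <= a + c ->
  a%:C%C * z ^+ 2 - b%:C%C * z + c%:C%C = 0 -> `|z| <= 1.
Proof.
case: z => x y a0 ca; rewrite ler_norml => /andP[b1 b2].
move=> /eqP; rewrite expr2 eq_complex /= => /andP[/eqP hr /eqP hi].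
rewrite normc_def /= -[1]/(1%:C%C) lecR -[leRHS]sqrtr1 ler_wsqrtr //.
have [y0|y0] := eqVneq y 0.
  have h : a * x ^+ 2 - b * x + c = 0 by rewrite -hr y0; ring.
  rewrite y0 expr0n /= addr0.
  have [x1|x1] := leP x 1; last first.
    (* The two products add up to a x^2 - b x + c, which would then be positive. *)
    have : 0 < (x - 1) * (a * x - c) by apply: mulr_gt0; nra.
    have : 0 <= (a + c - b) * x by apply: mulr_ge0; lra.
    by nra.
  have [x2|x2] := leP (-1) x; first by nra.
  have : 0 < (- x - 1) * (- (a * x) - c) by apply: mulr_gt0; nra.
  have : 0 <= (a + c + b) * - x by apply: mulr_ge0; lra.
  by nra.
(* For a nonreal root the imaginary part of the equation gives b = 2 a x; then x^2 + y^2, the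
   product of the conjugate roots, is c / a. *)
have e : 2 * a * x = b.
  apply: (mulIf y0); apply/eqP; rewrite -subr_eq0; apply/eqP.
  by rewrite -[RHS]hi; ring.
have : a * (x ^+ 2 + y ^+ 2) = c.
  apply/eqP; rewrite -subr_eq0; apply/eqP; rewrite -[RHS]oppr0 -[in RHS]hr -e.
  by ring.
nra.
Qed.

(** For symmetric [M] this is the Hermitian form at [r], written so that it is real by construction
    and hypotheses on real vectors apply. Rows are used because [eigenvalue] refers to left
    eigenvectors. *)
Definition herm_form (R : realType) n (M : 'M[R]_n) (r : 'rV[R[i]]_n) : R :=
  let a := map_mx (@complex.Re R) r in let b := map_mx (@complex.Im R) r in
  (a *m M *m a^T + b *m M *m b^T) 0 0.

Definition conj_col (R : realType) n (r : 'rV[R[i]]_n) : 'cV[R[i]]_n :=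
  \col_j (r 0 j)^*%C.

Lemma herm_formE (R : realType) n (M : 'M[R]_n) (r : 'rV[R[i]]_n) :
  M^T = M ->
  r *m cplx_mx M *m conj_col r = (herm_form M r)%:C%C%:M.
Proof.
move=> sM; pose a := map_mx (@complex.Re R) r.
pose b := map_mx (@complex.Im R) r.
have er : r = cplx_mx a + 'i%C *: cplx_mx b.
  by apply/rowP => j; rewrite !mxE -complexE.
have ec : conj_col r = cplx_mx a^T - 'i%C *: cplx_mx b^T.
  apply/colP => j; rewrite !mxE; case: (r 0 j) => x y.
  by apply/eqP; rewrite eq_complex /=; apply/andP; split; apply/eqP; ring.
rewrite [LHS]mx11_scalar; congr (_%:M).
rewrite ec {1}er /herm_form -/a -/b.
(* A one-by-one matrix equals its transpose; by symmetry of [M] the imaginary cross terms cancel. *)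
have cross : b *m M *m a^T = a *m M *m b^T.
  rewrite [LHS]mx11_scalar -[LHS]tr_scalar_mx -mx11_scalar.
  by rewrite !trmx_mul trmxK sM mulmxA.
rewrite mulmxDl mulmxDl !mulmxBr -!scalemxAl -!scalemxAr -!map_mxM /=.
rewrite cross !scalerA -expr2 sqr_i scaleN1r opprK addrA subrK.
by rewrite -map_mxD mxE.
Qed.

Lemma psdmx_herm_form_ge0 (R : realType) n (M : 'M[R]_n) (r : 'rV[R[i]]_n) :
  psdmx M -> 0 <= herm_form M r.
Proof.
move=> hM; rewrite /herm_form mxE addr_ge0 //.
  by have := hM (map_mx (@complex.Re R) r)^T; rewrite trmxK.
by have := hM (map_mx (@complex.Im R) r)^T; rewrite trmxK.
Qed.

Lemma herm_formB (R : realType) n (M P : 'M[R]_n) (r : 'rV[R[i]]_n) :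
  herm_form (M - P) r = herm_form M r - herm_form P r.
Proof. by rewrite /herm_form !mulmxBr !mulmxBl !mxE; ring. Qed.

Lemma herm_formZ (R : realType) n (a : R) (M : 'M[R]_n) (r : 'rV[R[i]]_n) :
  herm_form (a *: M) r = a * herm_form M r.
Proof. by rewrite /herm_form -!scalemxAr -!scalemxAl -scalerDr mxE. Qed.

Lemma herm_form1_gt0 (R : realType) n (r : 'rV[R[i]]_n) :
  r != 0 -> 0 < herm_form 1%:M r.
Proof.
move=> r0.
have e : herm_form 1%:M r
    = \sum_j ((complex.Re (r 0 j)) ^+ 2 + (complex.Im (r 0 j)) ^+ 2).
  rewrite /herm_form !mulmx1 !mxE -big_split /=; apply: eq_bigr => j _.
  by rewrite !mxE !expr2.
rewrite lt_neqAle e sumr_ge0 ?andbT => [|j _]; last first.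
  by rewrite addr_ge0 ?sqr_ge0.
apply: contra r0; rewrite eq_sym psumr_eq0 => [/allP h|j _]; last first.
  by rewrite addr_ge0 ?sqr_ge0.
apply/eqP/rowP => j; rewrite mxE; apply/eqP.
have := h j (mem_index_enum _).
by rewrite /= paddr_eq0 ?sqr_ge0 // !sqrf_eq0 eq_complex.
Qed.

(** Matrix of the recursion D u_(n+1) = P u_n - Q u_(n-1) on the pairs (u_(n-1), u_n). *)
Definition companion (F : fieldType) n (D P Q : 'M[F]_n) : 'M[F]_(n + n) :=
  block_mx 0 1%:M (- (invmx D *m Q)) (invmx D *m P).

Lemma companion_eigen_pencil (F : fieldType) n (D P Q : 'M[F]_n) (z : F) :
  D \in unitmx -> eigenvalue (companion D P Q) z ->
  exists2 r : 'rV_n, r != 0 & r *m (z ^+ 2 *: D - z *: P + Q) = 0.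
Proof.
move=> uD /eigenvalueP[v]; rewrite -[v]hsubmxK.
set p := lsubmx v; set q := rsubmx v.
rewrite /companion mul_row_block scale_row_mx => /eq_row_mx[].
rewrite mulmx0 add0r mulmx1 => hp hq v0.
(* The second block [q] of the eigenvector determines the first, so a zero witness would make the
   whole eigenvector vanish. *)
exists (q *m invmx D).
  apply: contra v0 => /eqP e.
  have q0 : q = 0 by rewrite -[q](mulmxKV uD) e mul0mx.
  by move: hq; rewrite q0 !mul0mx addr0 scaler0 => ->; rewrite row_mx0.
rewrite mulmxDr mulmxBr -!scalemxAr mulmxKV //.
have <- : z *: (z *: q) = z ^+ 2 *: q by rewrite scalerA expr2.
by rewrite -hq scalerDr -hp mulmxN !mulmxA addrK addNr.
Qed.

Lemma pencil_form (C : comPzRingType) n (K L : 'M[C]_n) (z h s k l : C)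
    (r : 'rV[C]_n) (w : 'cV[C]_n) :
  (r *m 1%:M *m w) 0 0 = s -> (r *m K *m w) 0 0 = k ->
  (r *m L *m w) 0 0 = l ->
  r *m (z ^+ 2 *: (1%:M + h *: L) - z *: (2%:M - K) + (1%:M - h *: L)) = 0 ->
  (s + h * l) * z ^+ 2 - (2 * s - k) * z + (s - h * l) = 0.
Proof.
pose f (M : 'M[C]_n) : C := (r *m M *m w) 0 0.
rewrite -!/(f _) => f1 fK fL hr.
have fD M P : f (M + P) = f M + f P by rewrite /f mulmxDr mulmxDl mxE.
have fZ a M : f (a *: M) = a * f M by rewrite /f -scalemxAr -scalemxAl mxE.
have fN M : f (- M) = - f M by rewrite -scaleN1r fZ mulN1r.
have := congr1 (fun u => (u *m w) 0 0) hr.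
rewrite -/(f _) mul0mx mxE -[2%:M]scalemx1; clearbody f.
by rewrite !(fD, fN, fZ) f1 fK fL => <-; ring.
Qed.

(** Pairing with the conjugate column gives a scalar quadratic with coefficients s + l/2, 2s - k and
    s - l/2, where s > 0, k and l are the forms of I, K and L at r. Jury's conditions become l >= 0
    and 0 <= k <= 4s. *)
Lemma acd_pencil_root_le1 (R : realType) n (K L : 'M[R]_n) (z : R[i])
    (r : 'rV[R[i]]_n) :
  K^T = K -> L^T = L -> psdmx K -> psdmx L -> pdmx (4%:M - K) -> r != 0 ->
  r *m (z ^+ 2 *: (1%:M + 2^-1 *: cplx_mx L) - z *: (2%:M - cplx_mx K)
        + (1%:M - 2^-1 *: cplx_mx L)) = 0 -> `|z| <= 1.
Proof.
move=> sK sL pK pL p4 r0 hr.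
have hs := herm_form1_gt0 r0.
have hk := psdmx_herm_form_ge0 r pK; have hl := psdmx_herm_form_ge0 r pL.
have hk4 : 0 <= herm_form (4%:M - K) r.
  apply: psdmx_herm_form_ge0 => x; have [->|x0] := eqVneq x 0.
    by rewrite mulmx0 mxE.
  by rewrite ltW // p4.
move: hk4; rewrite herm_formB -scalemx1 herm_formZ => hk4.
set s := herm_form 1%:M r in hs hk4; set k := herm_form K r in hk hk4.
set l := herm_form L r in hl.
apply: (@quadratic_root_norm_le1 _ (s + 2^-1 * l) (2 * s - k) (s - 2^-1 * l)).
- lra.
- lra.
- by rewrite ler_norml; apply/andP; split; lra.
have fM (M : 'M[R]_n) : M^T = M ->
    (r *m cplx_mx M *m conj_col r) 0 0 = (herm_form M r)%:C%C.
  by move=> sM; rewrite herm_formE // mxE mulr1n.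
have f1 := fM _ (trmx1 _ _); rewrite /cplx_mx map_mx1 in f1.
rewrite -(pencil_form f1 (fM _ sK) (fM _ sL) hr).
rewrite !rmorphB rmorphD !rmorphM /= !fmorphV /= !rmorph_nat; ring.
Qed.

(** * Linear recurrences under windowed harmonic forcing *)

(** Duhamel's formula, with [m] counting back from the latest force. *)
Lemma linear_recurrence_solution (C : comPzRingType) d (G : 'M[C]_d)
    (c : 'cV[C]_d) (f : nat -> C) (y : nat -> 'cV[C]_d) :
  y 0%N = 0 -> (forall n, y n.+1 = G *m y n + f n *: c) ->
  forall n, y n = \sum_(m < n) f (n - m.+1)%N *: (G ^+ m *m c).
Proof.
move=> y0 yS; elim=> [|n IHn]; first by rewrite big_ord0.
rewrite yS IHn big_ord_recl subSS subn0 expr0 mul1mx addrC; congr (_ + _).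
rewrite mulmx_sumr; apply: eq_bigr => m _.
by rewrite -scalemxAr subSS exprS -mulmxE mulmxA.
Qed.

Lemma mxexpZ (C : comPzRingType) d (a : C) (G : 'M[C]_d) n :
  (a *: G) ^+ n = a ^+ n *: G ^+ n.
Proof.
elim: n => [|n IHn]; first by rewrite !expr0 scale1r.
by rewrite !exprS IHn -!mulmxE -scalemxAl -scalemxAr scalerA.
Qed.

Lemma not_eigenvalue_unitmx (F : fieldType) d (G : 'M[F]_d) (z : F) :
  ~~ eigenvalue G z -> z%:M - G \in unitmx.
Proof.
rewrite /eigenvalue negbK => /eqP; rewrite /eigenspace => /eqP.
by rewrite kermx_eq0 row_free_unit -opprB -scaleN1r unitmxZ ?unitrN1.
Qed.

(** The vector (z - G) Y is the force that sustains the solution z^n Y under constant weight 1.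
    Divided by z^M, Duhamel's formula becomes the window sum of order 0 for W = z^-1 G. *)
Lemma windowed_recurrence_cvg (R : realType) (chi : R -> R) d
    (G : 'M[R[i]]_d.+1) (z : R[i]) (Y : 'cV[R[i]]_d.+1)
    (y : nat -> nat -> 'cV[R[i]]_d.+1) :
  (forall k, class_C k chi) -> chi 0 = 1 -> (forall x, 1 <= x -> chi x = 0) ->
  `|z| = 1 -> (forall a, eigenvalue G a -> `|a| <= 1) -> ~~ eigenvalue G z ->
  (forall M, y M 0%N = 0) ->
  (forall M n, (0 < M)%N -> y M n.+1 = G *m y M n
     + ((chi (1 - n%:R / M%:R))%:C%C * z ^+ n) *: ((z%:M - G) *m Y)) ->
  forall i, z ^- M * y M M i 0 @[M --> \oo] --> Y i 0.
Proof.
move=> Cchi chi1 chi0 z1 hG hz y0 yS i.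
have zn0 : z != 0 by rewrite -normr_gt0 z1.
have zu : z \is a GRing.unit by rewrite unitfE.
pose W := z^-1 *: G.
have zW : 1%:M - W = z^-1 *: (z%:M - G).
  by rewrite scalerBr scale_scalar_mx mulVf.
have uW : 1%:M - W \in unitmx.
  by rewrite zW unitmxZ ?unitrV // not_eigenvalue_unitmx.
have [p hp] := polybounded_mxexp hG.
have hW j k : polybounded p (fun n => (W ^+ n) j k).
  have [c hc] := hp j k; exists c => n.
  by rewrite mxexpZ mxE normrM normrX normfV z1 invr1 expr1n mul1r.
have := @window_sum_cvg _ _ _ _ _ Cchi chi1 chi0 hW uW Y i.
rewrite -cvg_shiftS => h; rewrite -cvg_shiftS.
suff e M : z ^- M.+1 * y M.+1 M.+1 i 0
    = window_sum chi W 0 ((1%:M - W) *m Y) i M.+1.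
  by under eq_fun do rewrite e.
rewrite (linear_recurrence_solution (y0 M.+1)
  (fun n => yS M.+1 n isT)).
rewrite summxE mulr_sumr /window_sum; apply: eq_bigr => m _.
have mM : (m <= M)%N by rewrite -ltnS.
rewrite /window_sample /=.
have -> : 1 - (M.+1 - m.+1)%:R / M.+1%:R = m.+1%:R / M.+1%:R :> R.
  by rewrite natrB // mulrBl divff ?pnatr_eq0 // opprB addrC subrK.
rewrite mxexpZ zW -!scalemxAl -scalemxAr scalerA.
rewrite mxE [in RHS]mxE subSS exprVn.
have -> : z ^+ M.+1 = z ^+ (M - m) * z ^+ m * z.
  by rewrite -exprD subnK // -exprSr.
by field; rewrite zn0 !expf_neq0.
Qed.

(** * The time-stepping scheme at the driving frequency *)

Lemma expiD (R : realType) (x y : R) : expi (x + y) = expi x * expi y.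
Proof.
apply/eqP; rewrite /expi cosD sinD eq_complex /=; apply/andP; split=> //.
by apply/eqP; ring.
Qed.

Lemma expi0 (R : realType) : expi (0 : R) = 1.
Proof. by rewrite /expi cos0 sin0. Qed.

Lemma expiMn (R : realType) (x : R) (n : nat) : expi (n%:R * x) = expi x ^+ n.
Proof.
elim: n => [|n IHn]; first by rewrite mul0r expi0.
by rewrite -natr1 mulrDl mul1r expiD IHn exprSr.
Qed.

Lemma norm_expi (R : realType) (x : R) : `|expi x| = 1.
Proof. by rewrite normc_def /= cos2Dsin2 sqrtr1. Qed.

Lemma expi_neq0 (R : realType) (x : R) : expi x != 0.
Proof. by rewrite -normr_gt0 norm_expi. Qed.

Lemma expiN (R : realType) (x : R) : expi (- x) = (expi x)^-1.
Proof.
by apply: (mulIf (expi_neq0 x)); rewrite mulVf ?expi_neq0 // -expiD addNr expi0.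
Qed.

(** At a nonzero row of the left kernel the forms of I and L/2 would add up to 0, though the first
    is positive and the second nonnegative. *)
Lemma unitmx_1psd (R : realType) n (L : 'M[R]_n) :
  L^T = L -> psdmx L -> 1%:M + 2^-1 *: cplx_mx L \in unitmx.
Proof.
move=> sL pL; rewrite unitmxE unitfE; apply/negP => /det0P[r r0 hr].
have hs := herm_form1_gt0 r0; have hl := psdmx_herm_form_ge0 r pL.
have f1 : r *m conj_col r = (herm_form 1%:M r)%:C%C%:M.
  by rewrite -herm_formE ?trmx1 // /cplx_mx map_mx1 mulmx1.
have := congr1 (fun u => (u *m conj_col r) 0 0) hr.
rewrite mul0mx mulmxDr mulmx1 -scalemxAr mulmxDl -scalemxAl f1 herm_formE //.
rewrite !mxE !mulr1n => /eqP; apply/negP; rewrite gt_eqF //.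
by rewrite ltr_pwDl ?ltcR // mulr_ge0 ?invr_ge0 ?ler0n // ler0c.
Qed.

(** This is the purpose of [acd_alpha] and [acd_beta]: at z = e^(i omega dt) the discrete symbol is
    an exact multiple of the Helmholtz matrix. [c], [s], [I] stand for cosine, sine and i; the
    hypotheses on [z] are Euler's formulas multiplied by [z]. *)
Lemma pencil_helmholtz (F : numFieldType) n (A B : 'M[F]_n)
    (z k o c s I : F) :
  s != 0 -> z ^+ 2 + 1 = 2 * c * z -> z ^+ 2 - 1 = I * (2 * s) * z ->
  k * o ^+ 2 = 2 - 2 * c ->
  z ^+ 2 *: (1%:M + 2^-1 *: ((k * o / s) *: B)) - z *: (2%:M - k *: A)
    + (1%:M - 2^-1 *: ((k * o / s) *: B))
  = (z * k) *: ((- (o ^+ 2))%:M + (I * o) *: B + A).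
Proof.
move=> s0 zp zm ko; apply/matrixP => i j; rewrite !mxE.
rewrite -[2 *+ _]mulr_natr -[(- _) *+ _]mulr_natr; set d := (i == j)%:R.
transitivity (d * (z ^+ 2 + 1 - 2 * z)
  + 2^-1 * (k * o / s) * B i j * (z ^+ 2 - 1) + z * k * A i j); first by ring.
rewrite zp zm.
have -> : 2 * c = 2 - k * o ^+ 2 by rewrite ko; ring.
by field.
Qed.

Lemma acd_pencil_expi (R : realType) N (A B : 'M[R]_N) (omega dt : R) :
  omega != 0 -> dt != 0 -> sin (omega * dt) != 0 ->
  let z := expi (omega * dt) in
  z ^+ 2 *: (1%:M + 2^-1 *: cplx_mx (acd_L B omega dt))
    - z *: (2%:M - cplx_mx (acd_K A omega dt))
    + (1%:M - 2^-1 *: cplx_mx (acd_L B omega dt))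
  = (z * (dt ^+ 2 / acd_alpha omega dt)%:C%C) *: helmholtz A B omega.
Proof.
move=> o0 d0 s0 z.
have cs := cos2Dsin2 (omega * dt).
(* A cosine equal to 1 would force the sine to vanish. *)
have c1 : 2 - 2 * cos (omega * dt) != 0.
  apply: contra s0 => /eqP h; rewrite -sqrf_eq0; apply/eqP.
  have e : cos (omega * dt) = 1 by lra.
  by move: cs; rewrite e expr1n; lra.
have a0 : acd_alpha omega dt != 0.
  by rewrite mulf_neq0 ?invr_eq0 // expf_neq0 // mulf_neq0.
pose c : R[i] := (cos (omega * dt))%:C%C.
pose s : R[i] := (sin (omega * dt))%:C%C; pose o : R[i] := omega%:C%C.
pose ka := dt ^+ 2 / acd_alpha omega dt; rewrite -/ka; pose k : R[i] := ka%:C%C.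
have s0' : s != 0 by rewrite (inj_eq (@complexI R) _ 0).
have zp : z ^+ 2 + 1 = (2 * cos (omega * dt))%:C%C * z.
  by apply/eqP; rewrite expr2 eq_complex /=; apply/andP; split; apply/eqP; lra.
have zm : z ^+ 2 - 1 = 'i%C * (2 * sin (omega * dt))%:C%C * z.
  by apply/eqP; rewrite expr2 eq_complex /=; apply/andP; split; apply/eqP; lra.
rewrite !rmorphM /= rmorph_nat -/c in zp.
rewrite !rmorphM /= rmorph_nat -/s in zm.
have kE : ka * omega ^+ 2 = 2 - 2 * cos (omega * dt).
  by rewrite /ka /acd_alpha; field; rewrite c1 d0 o0.
have koE : k * o ^+ 2 = 2 - 2 * c.
  by rewrite -rmorphXn -rmorphM kE rmorphB rmorphM /= rmorph_nat.
have lE : (acd_beta omega dt * dt / acd_alpha omega dt)%:C%C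
    = k * o / s :> R[i].
  rewrite -fmorphV -!rmorphM; congr (_%:C%C).
  by rewrite /ka /acd_beta; field; rewrite s0 a0.
have eK : cplx_mx (acd_K A omega dt) = k *: cplx_mx A by exact: map_mxZ.
have eL : cplx_mx (acd_L B omega dt) = (k * o / s) *: cplx_mx B.
  by rewrite -lE; exact: map_mxZ.
have eH : helmholtz A B omega
    = (- o ^+ 2)%:M + ('i%C * o) *: cplx_mx B + cplx_mx A.
  by rewrite /helmholtz; congr (_%:M + _ + _); rewrite rmorphXn.
rewrite eK eL eH -/k.
exact: (pencil_helmholtz (cplx_mx A) (cplx_mx B) s0' zp zm koE).
Qed.

Lemma acd_coefficient_neq0 (R : realType) (omega dt : R) :
  omega != 0 -> dt != 0 -> sin (omega * dt) != 0 ->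
  dt ^+ 2 / acd_alpha omega dt != 0.
Proof.
move=> o0 d0 s0; rewrite mulf_neq0 ?invr_eq0 ?expf_neq0 //.
rewrite mulf_neq0 ?invr_eq0 ?expf_neq0 ?mulf_neq0 //.
apply: contra s0 => /eqP h; rewrite -sqrf_eq0; apply/eqP.
have e : cos (omega * dt) = 1 by lra.
by have := cos2Dsin2 (omega * dt); rewrite e expr1n; lra.
Qed.

Lemma acd_forceE (R : realType) N (omega dt : R) (chi : R -> R) (M n : nat)
    (F : 'cV[R[i]]_N) :
  omega != 0 -> dt != 0 -> (0 < M)%N ->
  acd_force omega dt chi (M%:R * (omega * dt) / (2 * pi)) F n
  = ((chi (1 - n%:R / M%:R))%:C%C * expi (omega * dt) ^+ n) *: F.
Proof.
move=> o0 d0 M0; rewrite /acd_force -expiMn.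
have p0 : pi != 0 :> R by rewrite gt_eqF // pi_gt0.
congr ((_ (chi (1 - _)) * expi _) *: F); last by ring.
move: p0; generalize (pi : R) => p p0.
by field; rewrite p0 d0 o0 pnatr_eq0 -lt0n M0.
Qed.

Definition acd_companion (R : realType) N (A B : 'M[R]_N) (omega dt : R) :
    'M[R[i]]_(N + N) :=
  companion (1%:M + 2^-1 *: cplx_mx (acd_L B omega dt))
    (2%:M - cplx_mx (acd_K A omega dt))
    (1%:M - 2^-1 *: cplx_mx (acd_L B omega dt)).

(** [T] is expressed through the number of steps [M], which turns the limit in [T] into the limit of
    a sequence. *)
Definition acd_state (R : realType) N (A B : 'M[R]_N) (omega dt : R)
    (chi : R -> R) (F : 'cV[R[i]]_N) (M n : nat) : 'cV[R[i]]_(N + N) :=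
  let p := acd_pair A B omega dt chi (M%:R * (omega * dt) / (2 * pi)) F n in
  col_mx p.1 p.2.

(** The column is the pair (u_(-1), u_0) for u_n = z^n U. The first block row of the companion
    matrix only shifts, so the residual sits in the second block, where the pencil acts on [U]. *)
Lemma companion_harmonic (C : fieldType) n (D P Q H : 'M[C]_n) (z k : C)
    (U : 'cV[C]_n) :
  z != 0 -> D \in unitmx -> z ^+ 2 *: D - z *: P + Q = (z * k) *: H ->
  (z%:M - companion D P Q) *m col_mx (z^-1 *: U) U
  = col_mx 0 (invmx D *m (k *: (H *m U))).
Proof.
move=> z0 uD hz; rewrite mulmxBl /companion mul_block_col mul0mx mul1mx add0r.
rewrite mul_scalar_mx scale_col_mx scalerA divff // scale1r opp_col_mx.
rewrite add_col_mx addrN; congr col_mx.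
have -> : k *: (H *m U) = z *: (D *m U) - P *m U + z^-1 *: (Q *m U).
  have -> : k *: (H *m U) = z^-1 *: ((z * k) *: H *m U).
    by rewrite -scalemxAl scalerA mulKf.
  rewrite -hz !mulmxDl mulNmx -!scalemxAl !scalerDr scalerN !scalerA.
  by rewrite expr2 mulKf // mulVf // scale1r.
rewrite !mulmxDr mulmxN -!scalemxAr mulKmx // !mulNmx scalerN !mulmxA.
by rewrite opprD opprK addrA addrAC.
Qed.

Lemma acd_state_recurrence (R : realType) N (A B : 'M[R]_N) (omega dt : R)
    (chi : R -> R) (F : 'cV[R[i]]_N) (M n : nat) :
  omega != 0 -> dt != 0 -> sin (omega * dt) != 0 ->
  acd_L B omega dt = (acd_L B omega dt)^T -> psdmx (acd_L B omega dt) ->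
  helmholtz A B omega \in unitmx -> (0 < M)%N ->
  let z := expi (omega * dt) in
  let U := invmx (helmholtz A B omega) *m F in
  acd_state A B omega dt chi F M n.+1
  = acd_companion A B omega dt *m acd_state A B omega dt chi F M n
    + ((chi (1 - n%:R / M%:R))%:C%C * z ^+ n)
      *: ((z%:M - acd_companion A B omega dt) *m col_mx (z^-1 *: U) U).
Proof.
move=> o0 d0 s0 sL pL uH M0 z U.
have uD := unitmx_1psd (esym sL) pL.
rewrite (companion_harmonic U (expi_neq0 _) uD (acd_pencil_expi A B o0 d0 s0)).
rewrite /acd_state /= /acd_next acd_forceE //.
case: (acd_pair _ _ _ _ _ _ _ n) => v u /=.
rewrite mulKVmx // /acd_companion /companion.
set D := 1%:M + _; set P := 2%:M - _; set Q := 1%:M - _.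
clearbody D P Q; rewrite mul_block_col.
rewrite mul0mx mul1mx add0r scale_col_mx scaler0 add_col_mx addr0.
congr col_mx.
rewrite !mulmxDr mulmxN mulNmx -!scalemxAr !mulmxA.
by rewrite [in RHS](addrC (- _)) !scalerA mulrC.
Qed.

Lemma acd_companion_eigenvalue (R : realType) N (A B : 'M[R]_N)
    (omega dt : R) :
  let K := acd_K A omega dt in let L := acd_L B omega dt in
  K^T = K -> L^T = L -> psdmx K -> psdmx L -> pdmx (4%:M - K) ->
  forall z, eigenvalue (acd_companion A B omega dt) z -> `|z| <= 1.
Proof.
move=> K L sK sL pK pL p4 z hz.
have [r r0 hr] := companion_eigen_pencil (unitmx_1psd sL pL) hz.
exact: (acd_pencil_root_le1 sK sL pK pL p4 r0 hr).
Qed.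

(** At this point the pencil is a nonzero multiple of the invertible Helmholtz matrix, so no nonzero
    row annihilates it. *)
Lemma acd_companion_not_eigenvalue (R : realType) N (A B : 'M[R]_N)
    (omega dt : R) :
  omega != 0 -> dt != 0 -> sin (omega * dt) != 0 ->
  (acd_L B omega dt)^T = acd_L B omega dt -> psdmx (acd_L B omega dt) ->
  helmholtz A B omega \in unitmx ->
  ~~ eigenvalue (acd_companion A B omega dt) (expi (omega * dt)).
Proof.
move=> o0 d0 s0 sL pL uH; apply/negP => hz.
have [r r0] := companion_eigen_pencil (unitmx_1psd sL pL) hz.
rewrite (acd_pencil_expi A B o0 d0 s0) => hr.
have uP : (expi (omega * dt) * (dt ^+ 2 / acd_alpha omega dt)%:C%C)
    *: helmholtz A B omega \in unitmx.
  rewrite unitmxZ // unitfE mulf_neq0 ?expi_neq0 //.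
  by rewrite (inj_eq (@complexI R) _ 0) acd_coefficient_neq0.
by move/eqP: r0; apply; rewrite -(mulmxK uP r) hr mul0mx.
Qed.

(** * Convergence of the solution operator *)

Lemma acd_mx_cvg (R : realType) (N : nat) (A B : 'M[R]_N.+1) (omega dt : R)
    (chi : R -> R) (F : 'cV[R[i]]_N.+1) (i : 'I_N.+1) :
  A^T = A -> B^T = B ->
  omega != 0 -> dt != 0 -> sin (omega * dt) != 0 ->
  helmholtz A B omega \in unitmx ->
  psdmx (acd_K A omega dt) -> psdmx (acd_L B omega dt) ->
  pdmx (4%:M - acd_K A omega dt) ->
  (forall k, admissible_window k chi) ->
  expi (omega * dt) ^- M
    * (acd_pair A B omega dt chi (M%:R * (omega * dt) / (2 * pi)) F M).2 i 0
    @[M --> \oo] --> (invmx (helmholtz A B omega) *m F) i 0.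
Proof.
move=> sA sB o0 d0 s0 uH pK pL p4 adm.
have sK : (acd_K A omega dt)^T = acd_K A omega dt by rewrite linearZ /= sA.
have sL : (acd_L B omega dt)^T = acd_L B omega dt by rewrite linearZ /= sB.
have Cchi k : class_C k chi by have [] := adm k.
have [_ _ chi1 chi0 _] := adm 0%N.
pose U := invmx (helmholtz A B omega) *m F; pose z := expi (omega * dt).
have y0 M : acd_state A B omega dt chi F M 0 = 0 by exact: col_mx0.
(* Iterate and limit are the lower blocks of the states, hence the coordinate [rshift N.+1 i]
   below. *)
rewrite -/U -(col_mxEd (z^-1 *: U) U i 0).
pose p M := acd_pair A B omega dt chi (M%:R * (omega * dt) / (2 * pi)) F M.
under eq_fun => M do rewrite -/(p M) -(col_mxEd (p M).1 (p M).2 i 0).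
exact: (@windowed_recurrence_cvg R chi _ (acd_companion A B omega dt) z
  (col_mx (z^-1 *: U) U) (acd_state A B omega dt chi F) Cchi chi1 chi0
  (norm_expi _) (acd_companion_eigenvalue sK sL pK pL p4)
  (acd_companion_not_eigenvalue o0 d0 s0 sL pL uH) y0
  (fun M n => acd_state_recurrence chi F n o0 d0 s0 (esym sL) pL uH)
  (rshift N.+1 i)).
Qed.

Lemma acd_times_steps (R : realType) (omega dt T : R) :
  0 < omega -> 0 < dt -> acd_times omega dt T ->
  let M := Num.truncn (acd_steps omega dt T) in
  acd_steps omega dt T = M%:R /\ T = M%:R * (omega * dt) / (2 * pi).
Proof.
move=> o0 d0 [T0 Tint] M.
have p0 : 0 < pi :> R := pi_gt0 R.
have sM : acd_steps omega dt T = M%:R.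
  rewrite /M truncnK // natrEint Tint /acd_steps.
  by rewrite !(mulr_ge0, invr_ge0) // ltW.
split=> //; rewrite -sM /acd_steps.
move: p0; generalize (pi : R) => p p0.
by field; rewrite !gt_eqF.
Qed.

(** As 2 pi T = M omega dt, the phase factor e^(-2 pi i T) is z^-M. *)
Lemma acd_mxE_steps (R : realType) N (A B : 'M[R]_N) (omega dt : R)
    (chi : R -> R) (M : nat) (i j : 'I_N) (T : R) :
  T = M%:R * (omega * dt) / (2 * pi) ->
  Num.truncn (acd_steps omega dt T) = M ->
  acd_mx A B omega dt chi T i j = expi (omega * dt) ^- M
    * (acd_pair A B omega dt chi (M%:R * (omega * dt) / (2 * pi))
         (delta_mx j 0) M).2 i 0.
Proof.
move=> eT eM; rewrite /acd_mx mxE /acd_op mxE eM /acd_iterate -eT.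
congr (_ * _); rewrite expiN -expiMn eT; congr (expi _)^-1.
have p0 : pi != 0 :> R by rewrite gt_eqF // pi_gt0.
by move: p0; generalize (pi : R) => p p0; field.
Qed.

Theorem theorem4 (R : realType) (N : nat) (A B : 'M[R]_N) (omega dt : R)
    (chi : R -> R) :
  A^T = A -> B^T = B ->
  0 < omega -> 0 < dt -> sin (omega * dt) != 0 ->
  helmholtz A B omega \in unitmx ->
  psdmx (acd_K A omega dt) -> psdmx (acd_L B omega dt) ->
  pdmx (4%:M - acd_K A omega dt) ->
  (forall k, admissible_window k chi) ->
  acd_mx A B omega dt chi T
    @[T --> within (acd_times omega dt) (+oo : set_system R)]
    --> invmx (helmholtz A B omega).
Proof.
move=> sA sB o0 d0 s0 uH pK pL p4 adm; apply/cvg_ballP => e e0.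
suff: \forall T \near within (acd_times omega dt) (+oo : set_system R),
    forall ij : 'I_N * 'I_N, ball (invmx (helmholtz A B omega) ij.1 ij.2) e
      (acd_mx A B omega dt chi T ij.1 ij.2).
  by apply: filterS => T h; split=> // i j; apply: (h (i, j)).
(* There are finitely many entries, so each may have its own threshold in [T]. *)
apply: filter_forall => -[i j] /=.
case: N => [|N] in A B sA sB uH pK pL p4 i j *; first by case: i.
have := @acd_mx_cvg R N A B omega dt chi (delta_mx j 0) i sA sB
  (lt0r_neq0 o0) (lt0r_neq0 d0) s0 uH pK pL p4 adm.
rewrite -colE mxE => /cvg_ballP/(_ e e0)[n _ hn].
rewrite near_withinE; near=> T => DT.
have [sT eT] := acd_times_steps o0 d0 DT.
rewrite (acd_mxE_steps _ _ _ _ _ eT) //; apply: hn => /=.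
(* The step count is proportional to [T], so the required number of steps becomes an explicit lower
   bound on [T]. *)
rewrite -(ler_nat R) -sT /acd_steps ler_pdivlMr // -ler_pdivrMl; last first.
  by rewrite !mulr_gt0 ?invr_gt0 // pi_gt0.
by near: T; apply: nbhs_pinfty_ge; rewrite num_real.
Unshelve. all: by end_near.
Qed.
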